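(* Let $\mu>0$, let $k,M$ be positive integers, and let $\hat\Psi^{\mu}(\zeta)$ be the fractional Taylor wavelets vector on $[0,1]$ with entries $\psi^{\mu}_{n,m}$, $n=1,\dots,2^{k-1}$, $m=0,\dots,M-1$. Then $$\int_0^{\zeta}\hat\Psi^{\mu}(t)\,dt\;\approx\;\mathcal P^{1}\,\hat\Psi^{\mu}(\zeta),$$ where $\mathcal P^{1}$ is the $2^{k-1}M\times 2^{k-1}M$ matrix whose entry in row $(n,m)$ and column $(r,l)$ is $\Theta^{\mu;nm}_{rl}$. That is, for all $n=1,\dots,2^{k-1}$ and $m=0,1,\dots,M-1$, $$\int_0^{\zeta}\psi^{\mu}_{n,m}(t)\,dt\;\approx\;\sum_{r=1}^{2^{k-1}}\sum_{l=0}^{M-1}\Theta^{\mu;nm}_{rl}\,\psi^{\mu}_{r,l}(\zeta),$$ where $$\Theta^{\mu;nm}_{rl}=\begin{cases}2^{\frac{k-1}{2}}\sqrt{2m+1}\,(2^{k-1})^{m}\,c^{1m}_{rl}, & n=1,\\[4pt] 2^{\frac{k-1}{2}}\sqrt{2m+1}\,\displaystyle\sum_{s=0}^{m}2^{(k-1)s}(-1)^{m-s}(n-1)^{m-s}\binom{m}{s}\,c^{ns}_{rl}, & n\neq 1.\end{cases}$$ Here $\approx$ means that the right-hand side is the fractional Taylor wavelet expansion (as defined in the context) of the left-hand side, taken entrywise for vectors.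
   Context: Fractional Taylor wavelets: for a real $\mu>0$, positive integers $k,M$, $n=1,\dots,2^{k-1}$ and $m=0,\dots,M-1$, define on $[0,1)$ $$\psi^{\mu}_{n,m}(\zeta)=\begin{cases}2^{\frac{k-1}{2}}\sqrt{2m+1}\,(2^{k-1}\zeta^{\mu}-n+1)^{m}, & \left(\frac{n-1}{2^{k-1}}\right)^{1/\mu}\le\zeta<\left(\frac{n}{2^{k-1}}\right)^{1/\mu},\\ 0,&\text{otherwise,}\end{cases}$$ (with $0$th powers equal to $1$). The wavelets vector is the column vector $\hat\Psi^{\mu}=[\psi^{\mu}_{1,0},\dots,\psi^{\mu}_{1,M-1},\psi^{\mu}_{2,0},\dots,\psi^{\mu}_{2^{k-1},M-1}]^{T}$ of length $2^{k-1}M$; rows and columns of matrices are indexed by pairs in this order. Fractional Taylor wavelet expansion: put $\hat D(\mu)=\int_0^1\hat\Psi^{\mu}(\zeta)(\hat\Psi^{\mu}(\zeta))^{T}d\zeta$. A square integrable function $f$ on $[0,1]$ has expansion $f\approx \hat C^{T}\hat\Psi^{\mu}$ with coefficient row vector $$\hat C^{T}=\Big(\int_0^1 f(\zeta)(\hat\Psi^{\mu}(\zeta))^{T}d\zeta\Big)\hat D(\mu)^{-1}$$ (i.e. the $L^2[0,1]$-orthogonal projection onto the span of the wavelets). Coefficients $c^{ns}_{rl}$: for $1\le n\le 2^{k-1}$ and $0\le s\le M-1$ let $$g_{ns}(\zeta)=\int_0^{\zeta}t^{\mu s}\,\chi_{\left[\left(\frac{n-1}{2^{k-1}}\right)^{1/\mu},\left(\frac{n}{2^{k-1}}\right)^{1/\mu}\right)}(t)\,dt,$$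 where $\chi_E$ is the indicator function of $E$. Then $c^{ns}_{rl}$ ($1\le r\le 2^{k-1}$, $0\le l\le M-1$) are the coefficients of the expansion $g_{ns}\approx\sum_{r=1}^{2^{k-1}}\sum_{l=0}^{M-1}c^{ns}_{rl}\psi^{\mu}_{r,l}$, i.e. the row vector $(c^{ns}_{rl})_{(r,l)}$ equals $\big(\int_0^1 g_{ns}(\zeta)(\hat\Psi^{\mu}(\zeta))^{T}d\zeta\big)\hat D(\mu)^{-1}$. *)

(* Defs.v *)
From HB Require Import structures.
From mathcomp Require Import all_boot all_order all_algebra.
From mathcomp Require Import all_classical all_reals all_analysis.

Set Implicit Arguments.
Unset Strict Implicit.
Unset Printing Implicit Defensive.

Import Order.TTheory GRing.Theory Num.Theory.
Import numFieldNormedType.Exports.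

Local Open Scope classical_set_scope.
Local Open Scope ring_scope.

Section FractionalTaylorWavelets.
Variable R : realType.

(* k and M are meant to be positive, so that k.-1 is k - 1.  In [wnode],
   [block], [ftw], [mono_int], [wc] and [Theta] the natural number n is the
   1-based index n = 1, ..., 2^(k-1); an ordinal n : 'I_(2 ^ k.-1) stands for
   the 1-based index n.+1. *)

Definition wnode (mu : R) (k n : nat) : R := (n%:R / 2 ^+ k.-1) `^ mu^-1.

Definition block (mu : R) (k n : nat) : set R :=
  `[wnode mu k n.-1, wnode mu k n[.

Definition ftw (mu : R) (k n m : nat) (x : R) : R :=
  if x \in block mu k n then
    2 `^ ((k.-1)%:R / 2) * Num.sqrt (2 * m%:R + 1) *
      (2 ^+ k.-1 * x `^ mu - n%:R + 1) ^+ m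
  else 0.

(* [mxvec] lists the pairs (n, m) in row-major order, i.e.
   (1, 0), ..., (1, M - 1), (2, 0), ..., (2^(k-1), M - 1). *)
Definition ftw_vec (mu : R) (k M : nat) (x : R) : 'cV[R]_(2 ^ k.-1 * M) :=
  (mxvec (\matrix_(n < 2 ^ k.-1, m < M) ftw mu k n.+1 m x))^T.

Definition int0 (f : R -> R) (x : R) : R :=
  \int[lebesgue_measure]_(t in `[0, x]) f t.

Definition square_integrable (f : R -> R) : Prop :=
  measurable_fun `[(0 : R), 1] f /\
  lebesgue_measure.-integrable `[(0 : R), 1] (EFin \o (fun x => f x ^+ 2)).

Definition gram (mu : R) (k M : nat) : 'M[R]_(2 ^ k.-1 * M) :=
  \matrix_(i, j) \int[lebesgue_measure]_(x in `[(0 : R), 1])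
    (ftw_vec mu k M x *m (ftw_vec mu k M x)^T) i j.

(* For mu > 0 the wavelets are linearly independent in L^2[0, 1], so the Gram
   matrix is nonsingular and [invmx] is its genuine inverse. *)
Definition wcoef (mu : R) (k M : nat) (f : R -> R) : 'rV[R]_(2 ^ k.-1 * M) :=
  (\row_j \int[lebesgue_measure]_(x in `[(0 : R), 1])
     (f x * (ftw_vec mu k M x)^T 0 j)) *m invmx (gram mu k M).

(* The relation f ≈ h: f is square integrable on [0, 1], C is its row of
   wavelet coefficients, and h is the corresponding combination of wavelets
   on [0, 1]. *)
Definition is_expansion (mu : R) (k M : nat) (f : R -> R)
    (C : 'rV[R]_(2 ^ k.-1 * M)) (h : R -> R) : Prop :=
  [/\ square_integrable f, C = wcoef mu k M f &
      forall x, 0 <= x <= 1 -> h x = (C *m ftw_vec mu k M x) 0 0].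

(* g_{n s}; [powR] satisfies 0 `^ 0 = 1. *)
Definition mono_int (mu : R) (k n s : nat) : R -> R :=
  int0 (fun t => t `^ (mu * s%:R) * \1_(block mu k n) t).

(* c^{n s}_{r l}, with (r, l) read as (r.+1, l) in 1-based indexing. *)
Definition wc (mu : R) (k M n s : nat) (r : 'I_(2 ^ k.-1)) (l : 'I_M) : R :=
  wcoef mu k M (mono_int mu k n s) 0 (mxvec_index r l).

Definition Theta (mu : R) (k M n m : nat) (r : 'I_(2 ^ k.-1)) (l : 'I_M) : R :=
  if n == 1%N then
    2 `^ ((k.-1)%:R / 2) * Num.sqrt (2 * m%:R + 1) * (2 ^+ k.-1) ^+ m *
      wc mu 1 m r l
  else
    2 `^ ((k.-1)%:R / 2) * Num.sqrt (2 * m%:R + 1) *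
      \sum_(0 <= s < m.+1)
        2 ^+ (k.-1 * s) * (-1) ^+ (m - s) * (n%:R - 1) ^+ (m - s) *
        'C(m, s)%:R * wc mu n s r l.

Definition Theta_row (mu : R) (k M n m : nat) : 'rV[R]_(2 ^ k.-1 * M) :=
  mxvec (\matrix_(r < 2 ^ k.-1, l < M) Theta mu n m r l).

(* The outer [mxvec] decodes the row index i as a pair (n, m): the entry at
   (mxvec_index n m, mxvec_index r l) is Theta mu n.+1 m r l. *)
Definition opmat (mu : R) (k M : nat) : 'M[R]_(2 ^ k.-1 * M) :=
  \matrix_(i, j)
    mxvec (\matrix_(n < 2 ^ k.-1, m < M) Theta_row mu k M n.+1 m 0 j) 0 i.

Lemma opmatE (mu : R) (k M : nat) (n r : 'I_(2 ^ k.-1)) (m l : 'I_M) :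
  opmat mu k M (mxvec_index n m) (mxvec_index r l) = Theta mu n.+1 m r l.
Proof. by rewrite mxE mxvecE mxE mxvecE mxE. Qed.

End FractionalTaylorWavelets.

(* Main.v *)
(* By the binomial theorem psi_{n,m} is a linear combination of the functions
   t^(mu s) chi_n(t), s <= m, chi_n being the indicator of the n-th block, so
   its primitive is the same combination of the g_{n s}.  The row of wavelet
   coefficients is linear on bounded measurable functions; each g_{n s} is
   monotone, hence of this kind.  For n = 1 the factor (n - 1)^(m - s) leaves
   only s = m, so both cases of Theta are one formula. *)

Require Import Defs.
From HB Require Import structures.
From mathcomp Require Import all_boot all_order all_algebra.
From mathcomp Require Import all_classical all_reals all_analysis.
From mathcomp Require Import measurable_realfun.
From mathcomp Require Import ring.

Set Implicit Arguments.
Unset Strict Implicit.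
Unset Printing Implicit Defensive.

Import Order.TTheory GRing.Theory Num.Theory.
Import numFieldNormedType.Exports.

Local Open Scope ring_scope.

(** * Integrals of finite linear combinations *)

Section LinearCombination.
Context d (T : measurableType d) (R : realType) (nu : {measure set T -> \bar R}).
Local Open Scope classical_set_scope.

Lemma integrable_lin_comb (D : set T) (I : Type) (s : seq I) (a : I -> R)
    (F : I -> T -> R) :
  measurable D -> (forall i, nu.-integrable D (EFin \o F i)) ->
  nu.-integrable D (EFin \o (fun x => \sum_(i <- s) a i * F i x)).
Proof.
move=> mD iF; have -> : EFin \o (fun x => \sum_(i <- s) a i * F i x) =
    (fun x => \sum_(i <- s) ((a i)%:E * (F i x)%:E))%E.
  by apply/funext => x /=; rewrite -sumEFin.
by apply: integrable_sum => // i _; exact: (integrableZl mD (a i) (iF i)).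
Qed.

Lemma Rintegral_lin_comb (D : set T) (I : Type) (s : seq I) (a : I -> R)
    (F : I -> T -> R) :
  measurable D -> (forall i, nu.-integrable D (EFin \o F i)) ->
  \int[nu]_(x in D) (\sum_(i <- s) a i * F i x) =
  \sum_(i <- s) a i * \int[nu]_(x in D) F i x.
Proof.
move=> mD iF; elim: s => [|i s IH].
  by under eq_Rintegral do rewrite big_nil; rewrite Rintegral_cst// mul0r big_nil.
under eq_Rintegral do rewrite big_cons.
rewrite big_cons -IH RintegralD ?RintegralZl//; last exact: integrable_lin_comb.
(* What remains is integrability of the head term, the one-element case of the previous lemma. *)
have := @integrable_lin_comb D I [:: i] a F mD iF.
by congr (nu.-integrable _ _); apply/funext => x /=; rewrite big_seq1.
Qed.

End LinearCombination.

(** * A class of functions stable under products *)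

Section BoundedMeasurable.
Context (R : realType).
Local Open Scope classical_set_scope.

(** Unlike integrability, this passes to products, as needed for squares and for integrands
    [f * psi]. *)
Definition bounded_measurable (D : set R) (f : R -> R) : Prop :=
  measurable_fun D f /\ exists C, forall x, D x -> `|f x| <= C.

Lemma eq_bounded_measurable (D : set R) (f g : R -> R) : {in D, f =1 g} ->
  bounded_measurable D f -> bounded_measurable D g.
Proof.
move=> fg [mf [C fC]]; split; first exact: eq_measurable_fun mf.
by exists C => x Dx; rewrite -fg ?inE//; exact: fC.
Qed.

Lemma bounded_measurableM (D : set R) (f g : R -> R) : bounded_measurable D f ->
  bounded_measurable D g -> bounded_measurable D (fun x => f x * g x).
Proof.
move=> [mf [C fC]] [mg [C' gC]]; split; first exact: measurable_funM.
by exists (C * C') => x Dx; rewrite normrM ler_pM ?fC ?gC.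
Qed.

Lemma bounded_measurable_lin_comb (D : set R) (I : Type) (s : seq I) (a : I -> R)
    (F : I -> R -> R) : (forall i, bounded_measurable D (F i)) ->
  bounded_measurable D (fun x => \sum_(i <- s) a i * F i x).
Proof.
move=> bF; split.
  apply: measurable_sum => i; apply: measurable_funM; last exact: (bF i).1.
  exact: measurable_cst.
have [C hC] := choice (fun i => (bF i).2).
exists (\sum_(i <- s) `|a i| * C i) => x Dx.
apply: le_trans (ler_norm_sum _ _ _) _; apply: ler_sum => i _.
by rewrite normrM ler_wpM2l ?hC.
Qed.

Lemma bounded_measurable_integrable (y : R) (f : R -> R) :
  bounded_measurable `[0, y] f ->
  lebesgue_measure.-integrable `[0, y] (EFin \o f).
Proof.
move=> [mf [C fC]]; apply: measurable_bounded_integrable => //.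
  (* The sign of [y] is free: the interval has measure [y - 0], or 0 when [y <= 0]. *)
  rewrite /= lebesgue_measure_itv/=; case: ifP => _; last exact: ltry.
  by rewrite -EFinB ltry.
exists C; split; first exact: num_real.
by move=> M CM x Dx; apply: le_trans (fC x Dx) (ltW CM).
Qed.

Lemma bounded_measurable_square_integrable (f : R -> R) :
  bounded_measurable `[0, 1] f -> square_integrable f.
Proof.
move=> bf; split; first exact: bf.1.
apply: bounded_measurable_integrable.
apply: eq_bounded_measurable (bounded_measurableM bf bf).
by move=> x _; rewrite expr2.
Qed.

End BoundedMeasurable.

(** * Wavelets, their primitives and coefficient rows *)

Section Wavelets.
Context (R : realType) (mu : R) (k : nat).
Hypothesis mu_gt0 : 0 < mu.
Local Open Scope classical_set_scope.

(** The integrand of g_{ns}, so that [int0 (piece n s)] unfolds to [mono_int mu k n s]. *)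
Let piece n s (t : R) : R := t `^ (mu * s%:R) * \1_(block mu k n) t.

(** The coefficient of y^s, where y = x^mu, in the polynomial giving psi_{n,m} on its block. *)
Let coef n m s : R := 2 `^ ((k.-1)%:R / 2) * Num.sqrt (2 * m%:R + 1) *
  (2 ^+ (k.-1 * s) * (-1) ^+ (m - s) * (n%:R - 1) ^+ (m - s) * 'C(m, s)%:R).

Lemma block_ge0 n (x : R) : x \in block mu k n -> 0 <= x.
Proof.
rewrite inE /block /= in_itv/= => /andP[+ _].
by apply: le_trans; exact: powR_ge0.
Qed.

Lemma ftw_lin_comb n m x :
  ftw mu k n m x = \sum_(0 <= s < m.+1) coef n m s * piece n s x.
Proof.
rewrite /ftw /piece; case: ifPn => xB; last first.
  by rewrite big1// => s _; rewrite indicE (negbTE xB) !mulr0.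
have x0 := block_ge0 xB.
(* [exprDn] puts the exponent [m - s] on the first summand, so the constant comes first. *)
have -> : 2 ^+ k.-1 * x `^ mu - n%:R + 1 = (-1) * (n%:R - 1) + 2 ^+ k.-1 * x `^ mu.
  by rewrite mulN1r opprB -addrA addrC (addrC (- _)).
rewrite exprDn mulr_sumr big_mkord; apply: eq_bigr => s _.
rewrite indicE xB mulr1 /coef powRrM powR_mulrn ?powR_ge0// !exprMn exprM.
by rewrite -mulr_natr; ring.
Qed.

Lemma piece_bounded_measurable n s (y : R) :
  bounded_measurable `[0, y] (piece n s).
Proof.
split.
  apply: measurable_funM; first exact: measurable_funTS (measurable_powR _).
  apply: measurable_indic; rewrite /block; exact: measurable_itv.
(* As [mu * s] is nonnegative, the power is largest at the right endpoint; the indicator is at most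
   1. *)
exists (y `^ (mu * s%:R)) => t /=; rewrite in_itv/= => /andP[t0 ty].
rewrite normrM ger0_norm ?powR_ge0// -[leRHS]mulr1 ler_pM ?powR_ge0//.
  apply: ge0_ler_powR; rewrite ?nnegrE//; last exact: le_trans ty.
  by rewrite mulr_ge0 ?ler0n ?ltW.
by rewrite indicE; case: (_ \in _); rewrite ?normr1 ?normr0.
Qed.

Lemma piece_ge0 n s t : 0 <= piece n s t.
Proof. by rewrite mulr_ge0 ?powR_ge0// indicE ler0n. Qed.

Lemma mono_int_homo n s : {homo mono_int mu k n s : x y / x <= y}.
Proof.
(* [fine] preserves order between finite values, so both integrals are first shown finite; a
   nonnegative integrand then gives monotonicity in the domain. *)
move=> x y xy; rewrite /mono_int /int0 /Rintegral fine_le//.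
- apply: integrable_fin_num => //.
  exact/bounded_measurable_integrable/piece_bounded_measurable.
- apply: integrable_fin_num => //.
  exact/bounded_measurable_integrable/piece_bounded_measurable.
apply: ge0_subset_integral => //.
- apply/measurable_EFinP; exact: (piece_bounded_measurable n s y).1.
- by move=> t _; rewrite lee_fin; exact: piece_ge0.
- by apply: subset_itvl; rewrite bnd_simp.
Qed.

Lemma mono_int_bounded_measurable n s :
  bounded_measurable `[0, 1] (mono_int mu k n s).
Proof.
split; first by apply: nondecreasing_measurable => //; exact: mono_int_homo.
exists (mono_int mu k n s 1) => x /=; rewrite in_itv/= => /andP[_ x1].
rewrite ger0_norm ?mono_int_homo//.
by apply: Rintegral_ge0 => t _; exact: piece_ge0.
Qed.

Lemma ftw_bounded_measurable n m : bounded_measurable `[0, 1] (ftw mu k n m).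
Proof.
have -> : ftw mu k n m = fun x => \sum_(0 <= s < m.+1) coef n m s * piece n s x.
  by apply/funext => x; exact: ftw_lin_comb.
by apply: bounded_measurable_lin_comb => s; exact: piece_bounded_measurable.
Qed.

Lemma int0_ftw n m : int0 (ftw mu k n m) =
  fun x => \sum_(0 <= s < m.+1) coef n m s * mono_int mu k n s x.
Proof.
apply/funext => x; rewrite /int0; under eq_Rintegral do rewrite ftw_lin_comb.
rewrite Rintegral_lin_comb// => s.
exact/bounded_measurable_integrable/piece_bounded_measurable.
Qed.

(** The row of integrals against the wavelets is linear in the function, and is then multiplied by a
    fixed matrix. *)
Lemma wcoef_lin_comb M (I : Type) (s : seq I) (a : I -> R) (F : I -> R -> R) :
  (forall i, bounded_measurable `[0, 1] (F i)) ->
  wcoef mu k M (fun x => \sum_(i <- s) a i * F i x) =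
  \sum_(i <- s) a i *: wcoef mu k M (F i).
Proof.
move=> bF; rewrite /wcoef.
under [RHS]eq_bigr do rewrite scalemxAl.
rewrite -mulmx_suml; congr (_ *m _); apply/rowP => j.
rewrite summxE mxE; under [RHS]eq_bigr do rewrite !mxE.
under eq_Rintegral => x _.
  by rewrite mulr_suml; under eq_bigr do rewrite -mulrA; over.
rewrite Rintegral_lin_comb// => i.
apply: bounded_measurable_integrable; apply: bounded_measurableM => //.
case/mxvec_indexP: j => r l.
apply: (@eq_bounded_measurable _ _ (ftw mu k r.+1 l)).
  by move=> x _; rewrite !mxE mxvecE mxE.
exact: ftw_bounded_measurable.
Qed.

Lemma Theta_lin_comb M n m (r : 'I_(2 ^ k.-1)) (l : 'I_M) :
  Theta mu n m r l = \sum_(0 <= s < m.+1) coef n m s * wc mu n s r l.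
Proof.
rewrite /Theta; case: eqP => [->|_]; last first.
  by rewrite mulr_sumr; apply: eq_bigr => s _; rewrite /coef -!mulrA.
(* Here [n - 1] is 0: the last term survives because 0^0 = 1, and the terms with [s < m] vanish. *)
rewrite big_nat_recr//= big_nat big1 ?add0r => [|s /= sm].
  by rewrite /coef subnn !expr0 binn !mulr1 exprM.
rewrite /coef subrr expr0n subn_eq0 leqNgt sm/=.
by rewrite !(mulr0, mul0r).
Qed.

Lemma wcoef_int0_ftw M n m :
  wcoef mu k M (int0 (ftw mu k n m)) = Theta_row mu k M n m.
Proof.
rewrite int0_ftw wcoef_lin_comb => [|s]; last exact: mono_int_bounded_measurable.
apply/rowP => j; case/mxvec_indexP: j => r l.
rewrite summxE mxvecE mxE Theta_lin_comb.
by apply: eq_bigr => s _; rewrite mxE.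
Qed.

(** Leaving [h] free covers both the matrix form and the double-sum form of the right-hand side. *)
Lemma ftw_is_expansion M n m (h : R -> R) :
  (forall x, 0 <= x <= 1 -> h x = (Theta_row mu k M n m *m ftw_vec mu k M x) 0 0) ->
  is_expansion mu (int0 (ftw mu k n m)) (Theta_row mu k M n m) h.
Proof.
move=> hE; split => //; last by rewrite wcoef_int0_ftw.
apply: bounded_measurable_square_integrable; rewrite int0_ftw.
by apply: bounded_measurable_lin_comb => s; exact: mono_int_bounded_measurable.
Qed.

End Wavelets.

Theorem theorem5p1 (R : realType) (mu : R) (k M : nat)
    (mu_gt0 : 0 < mu) (k_gt0 : (0 < k)%N) (M_gt0 : (0 < M)%N) :
  (forall i : 'I_(2 ^ k.-1 * M),
     is_expansion mu
       (int0 (fun t => ftw_vec mu k M t i 0))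
       (row i (opmat mu k M))
       (fun x => (opmat mu k M *m ftw_vec mu k M x) i 0)) /\
  (forall (n : 'I_(2 ^ k.-1)) (m : 'I_M),
     is_expansion mu
       (int0 (ftw mu k n.+1 m))
       (Theta_row mu k M n.+1 m)
       (fun x => \sum_(r < 2 ^ k.-1) \sum_(l < M)
          Theta mu n.+1 m r l * ftw mu k r.+1 l x)).
Proof.
split=> [i|n m].
  case/mxvec_indexP: i => n m.
  have -> : (fun t => ftw_vec mu k M t (mxvec_index n m) 0) = ftw mu k n.+1 m.
    by apply/funext => t; rewrite mxE mxvecE mxE.
  have rowE : row (mxvec_index n m) (opmat mu k M) = Theta_row mu k M n.+1 m.
    by apply/rowP => j; rewrite !mxE mxvecE mxE.
  rewrite rowE; apply: ftw_is_expansion => // x _.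
  by rewrite -rowE -row_mul [RHS]mxE.
apply: ftw_is_expansion => // x _.
(* Both sides become sums over pairs [(r, l)]: the column index is decoded, the double sum
   merged. *)
rewrite mxE (reindex _ (curry_mxvec_bij _ _)) pair_bigA/=.
by apply: eq_bigr => -[r l] _ /=; rewrite mxvecE !mxE mxvecE mxE.
Qed.
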